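(* Let $S=k[x_1,\ldots,x_n]$ be a polynomial ring over a field $k$ and let $I\subset S$ be a squarefree monomial ideal generated in one degree, with minimal monomial generating set $G(I)=\{u_1,\ldots,u_m\}$, such that $\gcd(u_1,\ldots,u_m)=1$ and every variable $x_i$ divides at least one element of $G(I)$. Assume that $G_I\cong C_m$ (the cycle on $m$ vertices) with $m\ge 4$, where the generators are numbered so that $G_I$ is the cycle $u_1,u_2,\ldots,u_m,u_1$. Then the following conditions are equivalent: (a) $I$ has a linear resolution; (b) $m=n$ and, after a suitable relabeling of the variables, for all $j$ one has $x_i\mid u_j$ for all $i$ with $i\ne j$ and $i+1\neq j$, where indices are taken cyclically ($n+1=1$); (c) $I$ is a variable-decomposable ideal; (d) $I$ has linear quotients.
   Context: $G_I$ is the simple graph with vertex set $G(I)$ in which two distinct vertices $u_i,u_j$ are adjacent iff there exist variables $x,y$ with $xu_i=yu_j$. $I$ (generated in degree $d$) has a linear resolution if its minimal graded free resolution has the form $0\to S(-d-p)^{\beta_p}\to\cdots\to S(-d-1)^{\beta_1}\to S(-d)^{\beta_0}\to I\to 0$. $I$ has linear quotients if the elements of $G(I)$ can be ordered $v_1,\ldots,v_m$ so that for each $i=2,\ldots,m$ the colon ideal $\langle v_1,\ldots,v_{i-1}\rangle : v_i$ is generated by a subset of the variables. Variable-decomposable (for squarefree monomial ideals), recursively: $I$ is variable-decomposable if $|G(I)|=1$, or there is a variable $x_l$ such that, writing $I_{x_l}$ for the ideal generated by the elements of $G(I)$ not divisible by $x_l$ and $I^{x_l}$ for the ideal generated by the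 elements of $G(I)$ divisible by $x_l$, one has: $I_{x_l}\ne 0$; for each $u\in G(I_{x_l})$ there is $v\in G(I^{x_l})$ with $v/\gcd(u,v)=x_l$; and both $I_{x_l}$ and $I^{x_l}$ are variable-decomposable. *)

(* Defs.v *)
From mathcomp Require Import all_boot all_order all_fingroup all_algebra.
From mathcomp Require Import mpoly.
From Stdlib Require Classical_Prop.

Set Implicit Arguments.
Unset Strict Implicit.
Unset Printing Implicit Defensive.

Import GRing.Theory.
Local Open Scope ring_scope.

(* Ideals are Prop-valued predicates on S = {mpoly k[n]}: the ideals of
   ring_quotient are boolean (decidable) and proper, which is too narrow.
   A monomial x^w of S is represented by its exponent vector w : 'X_{1..n}, so
   that (u + v)%MM is the product, (u - v)%MM the quotient (when v divides u)
   and (u <= v)%MM divisibility. *)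

Definition ideal_gen (k : fieldType) (n : nat) (A : {mpoly k[n]} -> Prop)
    (f : {mpoly k[n]}) : Prop :=
  exists2 s : seq ({mpoly k[n]} * {mpoly k[n]}),
    (forall p, p \in s -> A p.2) & f = \sum_(p <- s) p.1 * p.2.

Definition mon_ideal (k : fieldType) (n : nat) (A : 'X_{1..n} -> Prop) :
    {mpoly k[n]} -> Prop :=
  ideal_gen (fun f => exists2 w, A w & f = 'X_[w]).

Definition squarefree (n : nat) (w : 'X_{1..n}) : Prop :=
  forall i, (w i <= 1)%N.

Definition squarefree_monomial_ideal (k : fieldType) (n : nat)
    (I : {mpoly k[n]} -> Prop) : Prop :=
  exists2 A : 'X_{1..n} -> Prop,
    (forall w, A w -> squarefree w) & (forall f, I f <-> mon_ideal A f).

(* G(I), as the set of monomials of I that are minimal under divisibility;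
   mon_gens_generate and mon_gens_least below show that, for a monomial ideal,
   it is the least monomial generating set. *)
Definition mon_gens (k : fieldType) (n : nat) (I : {mpoly k[n]} -> Prop)
    (w : 'X_{1..n}) : Prop :=
  I 'X_[w] /\ forall v : 'X_{1..n}, I 'X_[v] -> (v <= w)%MM -> v = w.

Lemma mon_ideal_mem (k : fieldType) (n : nat) (A : 'X_{1..n} -> Prop)
    (w : 'X_{1..n}) :
  mon_ideal A 'X_[k, w] <-> exists2 v, A v & (v <= w)%MM.
Proof.
split=> [[s sA sE]|[v Av vw]]; last first.
  exists [:: ('X_[w - v], 'X_[v])]; last by rewrite big_seq1 -mpolyXD submK.
  by move=> p; rewrite inE => /eqP->; exists v.
have nz : (\sum_(p <- s) p.1 * p.2)@_w != 0.
  by rewrite -sE mcoeffX eqxx oner_neq0.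
have [p ps pw] : exists2 p, p \in s & (p.1 * p.2)@_w != 0.
  apply/hasP; apply: contraNT nz => /hasPn h.
  by rewrite raddf_sum big_seq big1 // => p /h; rewrite negbK => /eqP.
have [v Av pE] := sA p ps; exists v => //.
move: pw; rewrite pE -mcoeff_msupp => /msuppM_le /allpairsP[[a b] /=].
by case=> _; rewrite msuppX inE => /eqP-> ->; apply: lem_addl.
Qed.

Lemma mon_gens_least (k : fieldType) (n : nat) (I : {mpoly k[n]} -> Prop)
    (A : 'X_{1..n} -> Prop) :
  (forall f, I f <-> mon_ideal A f) -> forall w, mon_gens I w -> A w.
Proof.
move=> IA w [/IA/mon_ideal_mem[v Av vw] wmin].
by rewrite -(wmin v) // IA; apply/mon_ideal_mem; exists v; rewrite ?lepm_refl.
Qed.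

Lemma mon_gens_below (k : fieldType) (n : nat) (I : {mpoly k[n]} -> Prop)
    (w : 'X_{1..n}) :
  I 'X_[w] -> exists2 v, mon_gens I v & (v <= w)%MM.
Proof.
move: {2}(mdeg w) (leqnn (mdeg w)) => d; elim: d w => [|d IHd] w wd Iw.
  exists w; rewrite ?lepm_refl //; split=> // v _ /mnm_lepP vw.
  move: wd; rewrite leqn0 mdeg_eq0 => /eqP w0; apply/mnmP => i.
  by move: (vw i); rewrite w0 mnm0E leqn0 => /eqP.
have [Gw|nGw] := Classical_Prop.classic (mon_gens I w).
  by exists w; rewrite ?lepm_refl.
have [v [Iv vw v_neq]] : exists v, [/\ I 'X_[v], (v <= w)%MM & v <> w].
  apply: Classical_Prop.NNPP => nv; apply: nGw; split=> // v Iv vw.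
  by apply: Classical_Prop.NNPP => v_neq; apply: nv; exists v.
have [|//|u Gu uv] := IHd v; last by exists u; rewrite ?(lepm_trans uv vw).
have := submK vw => wE; rewrite -ltnS (leq_trans _ wd) // -wE mdegD.
rewrite -[X in (X < _)%N]add0n ltn_add2r lt0n mdeg_eq0.
by apply/eqP => z; apply: v_neq; rewrite -wE z add0m.
Qed.

Lemma mon_gens_generate (k : fieldType) (n : nat) (I : {mpoly k[n]} -> Prop)
    (A : 'X_{1..n} -> Prop) :
  (forall f, I f <-> mon_ideal A f) ->
  forall f, I f <-> mon_ideal (mon_gens I) f.
Proof.
move=> IA f; split; last first.
  move=> [s sG ->]; apply/IA; exists s => // p /sG [w Gw ->].
  by exists w => //; apply: mon_gens_least IA _ Gw.
move=> /IA [s sA ->].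
have gen0 : mon_ideal (mon_gens I) (0 : {mpoly k[n]}).
  by exists [::]; rewrite ?big_nil.
elim: s sA => [|p s IHs] sA; first by rewrite big_nil.
have [|t tG tE] := IHs.
  by move=> q qs; apply: sA; rewrite inE qs orbT.
have [|w Aw pE] := sA p; first by rewrite inE eqxx.
have [|v Gv vw] := @mon_gens_below k n I w.
  by apply/IA/mon_ideal_mem; exists w; rewrite ?lepm_refl.
exists ((p.1 * 'X_[w - v], 'X_[v]) :: t).
  by move=> q; rewrite inE => /predU1P[->|/tG //]; exists v.
by rewrite !big_cons tE /= pE -mulrA -mpolyXD submK.
Qed.

Definition generated_in_degree (k : fieldType) (n : nat)
    (I : {mpoly k[n]} -> Prop) (d : nat) : Prop :=
  forall w, mon_gens I w -> mdeg w = d.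

(* The adjacency relation of G_I, on the vertex set G(I). *)
Definition lin_adj (n : nat) (u v : 'X_{1..n}) : Prop :=
  u <> v /\ exists x y : 'I_n, (U_(x) + u)%MM = (U_(y) + v)%MM.

(* C_m on the vertices 'I_m, for m >= 3; ordS is the cyclic successor. *)
Definition cycle_adj (m : nat) (i j : 'I_m) : Prop := j = ordS i \/ i = ordS j.

(* f lies in S_(a - b), i.e. 1 |-> f defines a degree-0 map S(-a) -> S(-b). *)
Definition shift_homog (k : fieldType) (n : nat) (a b : nat)
    (f : {mpoly k[n]}) : bool :=
  if (b <= a)%N then f \is (a - b)%N.-homog else f == 0.

(* Minimal graded free resolution 0 -> F_p -> ... -> F_0 -> I -> 0, where
   F_i = \bigoplus_r S(-res_shift i r) is the module of row vectors
   'rV_(res_rank i) and maps act by right multiplication. Since F_i = 0 for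
   i > p, exactness at F_p is the injectivity of the leftmost map. Shifts are
   naturals because I, as an ideal of S, lives in nonnegative degrees. *)
Record min_graded_resolution (k : fieldType) (n : nat)
    (I : {mpoly k[n]} -> Prop) : Type := MinGradedResolution {
  res_length : nat;
  res_rank : nat -> nat;
  res_shift : forall i : nat, 'I_(res_rank i) -> nat;
  res_aug : 'cV[{mpoly k[n]}]_(res_rank 0);
  res_diff : forall i : nat, 'M[{mpoly k[n]}]_(res_rank i.+1, res_rank i);
  res_finite : forall i : nat, (res_length < i)%N -> res_rank i = 0%N;
  res_aug_homog : forall r : 'I_(res_rank 0),
    res_aug r 0 \is (res_shift r).-homog;
  res_diff_homog : forall (i : nat) (r : 'I_(res_rank i.+1))
      (c : 'I_(res_rank i)),
    shift_homog (res_shift r) (res_shift c) (res_diff i r c);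
  res_aug_onto : forall f : {mpoly k[n]},
    I f <-> exists v : 'rV_(res_rank 0), f = (v *m res_aug) 0 0;
  res_exact0 : forall v : 'rV_(res_rank 0),
    v *m res_aug = 0 <-> exists w : 'rV_(res_rank 1), v = w *m res_diff 0;
  res_exactS : forall (i : nat) (v : 'rV_(res_rank i.+1)),
    v *m res_diff i = 0 <->
    exists w : 'rV_(res_rank i.+2), v = w *m res_diff i.+1;
  (* minimality: the image of F_(i+1) lies in <x_1, ..., x_n> F_i *)
  res_minimal : forall (i : nat) (r : 'I_(res_rank i.+1))
      (c : 'I_(res_rank i)),
    ideal_gen (fun f => exists l : 'I_n, f = 'X_l) (res_diff i r c)
}.

Definition has_linear_resolution (k : fieldType) (n : nat)
    (I : {mpoly k[n]} -> Prop) (d : nat) : Prop :=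
  exists R : min_graded_resolution I,
    forall (i : nat) (r : 'I_(res_rank R i)), res_shift r = (d + i)%N.

Definition colon_ideal (k : fieldType) (n : nat) (J : {mpoly k[n]} -> Prop)
    (w : 'X_{1..n}) (f : {mpoly k[n]}) : Prop :=
  J (f * 'X_[w]).

Definition has_linear_quotients (k : fieldType) (n : nat)
    (I : {mpoly k[n]} -> Prop) : Prop :=
  exists v : seq 'X_{1..n},
    [/\ uniq v, forall w, mon_gens I w <-> w \in v
      & forall i : nat, (0 < i < size v)%N -> exists A : {set 'I_n},
          forall f : {mpoly k[n]},
            colon_ideal (mon_ideal (fun w => w \in take i v)) (nth 0%MM v i) f
            <-> ideal_gen (fun g => exists2 l, l \in A & g = 'X_l) f].

Definition mgcd (n : nat) (u v : 'X_{1..n}) : 'X_{1..n} :=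
  [multinom minn (u i) (v i) | i < n].

(* I_{x_l} and I^{x_l} *)
Definition ideal_without (k : fieldType) (n : nat) (I : {mpoly k[n]} -> Prop)
    (l : 'I_n) : {mpoly k[n]} -> Prop :=
  mon_ideal (fun w => mon_gens I w /\ ~~ (U_(l) <= w)%MM).

Definition ideal_with (k : fieldType) (n : nat) (I : {mpoly k[n]} -> Prop)
    (l : 'I_n) : {mpoly k[n]} -> Prop :=
  mon_ideal (fun w => mon_gens I w /\ (U_(l) <= w)%MM).

Inductive variable_decomposable (k : fieldType) (n : nat)
    (I : {mpoly k[n]} -> Prop) : Prop :=
| VarDecSingle of (exists w, forall v, mon_gens I v <-> v = w)
| VarDecStep (l : 'I_n) of
    (exists2 f, ideal_without I l f & f != 0) &
    (forall u, mon_gens (ideal_without I l) u ->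
       exists2 v, mon_gens (ideal_with I l) v & (v - mgcd u v)%MM = U_(l)%MM) &
    variable_decomposable (ideal_without I l) &
    variable_decomposable (ideal_with I l).

(* Main.v *)
Require Import Defs.
From mathcomp Require Import all_boot all_order all_fingroup all_algebra.
From mathcomp Require Import mpoly zify.

Set Implicit Arguments.
Unset Strict Implicit.
Unset Printing Implicit Defensive.

Import GRing.Theory.
Local Open Scope ring_scope.

(** Write B_j for the set of variables that do not divide u_j, and let b_j, a_j
    be the variables with b_j u_j = a_j u_(j+1): from u_j to u_(j+1), b_j is
    gained and a_j is lost. Since C_m has no triangle for m >= 4, the variables
    a_(j-1) and b_j are distinct; both belong to B_j, so d <= n - 2. The whole
    theorem turns around the case of equality, where every B_j has two elements.

    In this case B_j = {b_j, b_(j+1)}, and j |-> b_j is a bijection onto the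
    variables, since a variable in three sets B_j would give a triangle: this is
    the cyclic labelling of the variables (cyclic_labelling), and conversely
    such a labelling bounds #|B_j| by 2 (card_missing_of_labelling). It remains
    to see that each of the other conditions is equivalent to this one, or lies
    between two that are.

    - The variable b_j separates the cycle into two arcs, and it separates u_j
      from the other generators of an arc starting at u_j, so I is variable
      decomposable (cycle_variable_decomposable). Shedding one variable at a
      time lists the generators in an order with linear quotients
      (variable_decomposable_linear_quotients).
    - Given linear quotients, all generators but the first and the last come
      after exactly one of their two neighbours (unique_peak). The corresponding
      colon ideals are generated by single variables, which are m - 2 distinct
      divisors of the first generator. As every variable is lost on some edge,
      n <= m, and d >= m - 2 >= n - 2 (linear_quotients_card_missing).
    - Let s be the matrix of the relations b_j u_j = a_j u_(j+1). All linear
      syzygies of the generators are combinations of its rows (linear_syzygies).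
      Its own syzygies are the multiples of one row c, with entries of degree
      n - d - 1, because z s = 0 makes z_j b_j u_j independent of j, hence
      divisible by all variables (edge_syzygies_kernel). A linear resolution
      has linear second syzygies, which forces n - d - 1 <= 1
      (linear_resolution_card_missing).
    - If d = n - 2, then c is linear and every syzygy of the generators is a
      combination of rows of s (generators_syzygies), so that
      0 -> S -> S^m -> S^m -> I -> 0, with the maps c, s and (u_1, ..., u_m), is
      a linear resolution (cycle_linear_resolution). *)

(** * Monomial ideals and supports of polynomials *)

Section MonomialIdeals.

Variables (k : fieldType) (n : nat).
Implicit Types (A : 'X_{1..n} -> Prop) (f g : {mpoly k[n]}).

Lemma mon_ideal_sum A (J : eqType) (r : seq J) (F : J -> {mpoly k[n]}) :
  (forall i, i \in r -> mon_ideal A (F i)) -> mon_ideal A (\sum_(i <- r) F i).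
Proof.
elim: r => [|i r IHr] rA; first by exists [::]; rewrite ?big_nil.
have [s sA sE] := rA i (mem_head _ _).
have [|t tA tE] := IHr; first by move=> j jr; apply: rA; rewrite inE jr orbT.
exists (s ++ t); last by rewrite big_cons big_cat -sE -tE.
by move=> p; rewrite mem_cat => /orP[/sA|/tA].
Qed.

(** Membership in a monomial ideal only concerns the exponent vectors of the
    terms; this reduces every ideal computation below to divisibility of
    monomials. *)
Lemma mon_ideal_msuppP A f :
  mon_ideal A f <-> forall w, w \in msupp f -> exists2 v, A v & (v <= w)%MM.
Proof.
split=> [[s sA ->] w|fA].
  rewrite mcoeff_msupp raddf_sum => nz.
  have [p ps pw] : exists2 p, p \in s & (p.1 * p.2)@_w != 0.
    apply/hasP; apply: contraNT nz => /hasPn h.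
    by rewrite big_seq big1 // => p /h; rewrite negbK => /eqP.
  have [v Av pE] := sA p ps; exists v => //.
  move: pw; rewrite pE -mcoeff_msupp => /msuppM_le /allpairsP[[a b] /=].
  by case=> _; rewrite msuppX inE => /eqP-> ->; apply: lem_addl.
rewrite [f]mpolyE; apply: mon_ideal_sum => w /fA [v Av vw].
exists [:: (f@_w *: 'X_[w - v], 'X_[v])]; last first.
  by rewrite big_seq1 /= -scalerAl -mpolyXD submK.
by move=> p; rewrite inE => /eqP->; exists v.
Qed.

Lemma ideal_gen_ext (P Q : {mpoly k[n]} -> Prop) f :
  (forall g, P g <-> Q g) -> ideal_gen P f <-> ideal_gen Q f.
Proof. by move=> PQ; split=> -[s sP sE]; exists s => // p /sP /PQ. Qed.

Lemma variable_ideal_msuppP (V : {set 'I_n}) f :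
  ideal_gen (fun g => exists2 l, l \in V & g = 'X_l) f <->
  forall w, w \in msupp f -> exists2 l, l \in V & (0 < w l)%N.
Proof.
rewrite (@ideal_gen_ext _
  (fun g => exists2 w, (exists2 l, l \in V & w = U_(l)%MM) & g = 'X_[w])).
  have -> : ideal_gen (fun g => exists2 w, (exists2 l, l \in V & w = U_(l)%MM) &
    g = 'X_[w]) f <-> mon_ideal (fun w => exists2 l, l \in V & w = U_(l)%MM) f.
    by [].
  rewrite mon_ideal_msuppP; split=> fV w /fV.
    by case=> _ [l lV ->]; rewrite lep1mP -lt0n; exists l.
  by case=> l lV wl; exists U_(l)%MM; [exists l | rewrite lep1mP -lt0n].
move=> g; split=> [[l lV ->]|[_ [l lV ->] ->]]; last by exists l.
by exists U_(l)%MM; first exists l.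
Qed.

Lemma variable_ideal_pair x y f :
  ideal_gen (fun g => exists2 l, l \in [set x; y] & g = 'X_l) f ->
  exists g h, f = g * 'X_x + h * 'X_y.
Proof.
case=> s sV ->; elim: s sV => [|p s IHs] sV.
  by exists 0, 0; rewrite big_nil !mul0r addr0.
have [|g [h E]] := IHs; first by move=> q qs; apply: sV; rewrite inE qs orbT.
have [l lxy pE] := sV p (mem_head _ _); rewrite big_cons E pE.
move: lxy; rewrite in_set2 => /orP[]/eqP->.
  by exists (p.1 + g), h; rewrite mulrDl addrA.
by exists g, (p.1 + h); rewrite mulrDl addrCA.
Qed.

Lemma mpolyX_factor w f :
  (forall v, v \in msupp f -> (w <= v)%MM) -> exists g, f = g * 'X_[w].
Proof.
move=> fw; have /mon_ideal_msuppP[s sw ->] :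
    forall v, v \in msupp f -> exists2 z, z = w & (z <= v)%MM.
  by move=> v /fw; exists w.
exists (\sum_(p <- s) p.1); rewrite mulr_suml !big_seq.
by apply: eq_bigr => p /sw[_ -> ->].
Qed.

Lemma mpolyX_neq0 (w : 'X_{1..n}) : 'X_[k, w] != 0.
Proof. by rewrite -msupp_eq0 msuppX. Qed.

Lemma mulX_inj w : injective (fun f => f * 'X_[k, w]).
Proof. exact: mulIf (mpolyX_neq0 w). Qed.

Lemma mon_gens_antichain A :
  (forall v w, A v -> A w -> (v <= w)%MM -> v = w) ->
  forall w, mon_gens (@mon_ideal k n A) w <-> A w.
Proof.
move=> antiA w; split=> [|Aw]; first exact: mon_gens_least.
split=> [|v /mon_ideal_mem[z Az zv] vw].
  by apply/mon_ideal_mem; exists w; rewrite ?lepm_refl.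
have zE := antiA _ _ Az Aw (lepm_trans zv vw); subst z.
by apply/mnmP => i; apply/eqP; rewrite eqn_leq (mnm_lepP vw) (mnm_lepP zv).
Qed.

Lemma mcoeffMX_le f w v :
  (f * 'X_[w])@_v = if (w <= v)%MM then f@_(v - w) else 0.
Proof.
case: ifP => [wv|/negP wv]; first by rewrite -{1}(submK wv) addmC mcoeffMX.
apply/eqP; rewrite mcoeff_eq0 (perm_mem (msuppMX _ _)).
by apply/mapP => -[z _ vE]; apply: wv; rewrite vE lem_addr.
Qed.

Variable I : {mpoly k[n]} -> Prop.

Lemma mon_gens_anti v w : mon_gens I v -> mon_gens I w -> (v <= w)%MM -> v = w.
Proof. by move=> [Iv _] [_]; apply. Qed.

Lemma mon_gens_without l w :
  mon_gens (ideal_without I l) w <-> mon_gens I w /\ ~~ (U_(l) <= w)%MM.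
Proof.
by apply: mon_gens_antichain => v z [Gv _] [Gz _]; apply: mon_gens_anti.
Qed.

Lemma mon_gens_with l w :
  mon_gens (ideal_with I l) w <-> mon_gens I w /\ (U_(l) <= w)%MM.
Proof.
by apply: mon_gens_antichain => v z [Gv _] [Gz _]; apply: mon_gens_anti.
Qed.

End MonomialIdeals.

(** * Homogeneous matrices of polynomials *)

Section HomogeneousMatrices.

Variables (k : fieldType) (n : nat).

Definition homog_mx e p q (A : 'M[{mpoly k[n]}]_(p, q)) :=
  forall i j, A i j \is e.-homog.

Definition const_poly_mx p q (A : 'M[k]_(p, q)) : 'M[{mpoly k[n]}]_(p, q) :=
  map_mx (@mpolyC n k) A.

Lemma homog_mx_mul_const e p q r (A : 'M_(p, q)) (C : 'M_(q, r)) :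
  homog_mx e A -> homog_mx e (A *m const_poly_mx C).
Proof.
move=> Ae i j; rewrite mxE rpred_sum // => l _.
by rewrite mxE mulrC mul_mpolyC rpredZ.
Qed.

Lemma mcoeffM_homog e (f g : {mpoly k[n]}) v :
  g \is e.-homog -> mdeg v = e -> (f * g)@_v = f@_0 * g@_v.
Proof.
move=> ge ve; rewrite [g]mpolyE mulr_sumr !raddf_sum mulr_sumr !big_seq.
apply: eq_bigr => w /(dhomog_mf ge) /= we.
rewrite -scalerAr !mcoeffZ mcoeffMX_le mcoeffX mulrCA; congr (_ * _).
have [->|wv] := eqVneq w v; first by rewrite lepm_refl -{1}[v]add0m addmK mulr1.
case: ifP => [/submK wE|_]; last by rewrite mulr0.
case/eqP: wv; move/(congr1 mdeg): (wE); rewrite mdegD ve we => /eqP.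
rewrite -[X in _ == X]add0n eqn_add2r mdeg_eq0 => /eqP wv0.
by rewrite -wE wv0 add0m.
Qed.

(** A relation of degree 0 between homogeneous matrices of the same degree is
    already satisfied by the constant terms of the coefficients. This is what
    turns comparison maps between generating systems into base changes over
    k. *)
Lemma homog_mx_factor e p q r (V : 'M_(p, q)) (B : 'M_(q, r)) :
  homog_mx e (V *m B) -> homog_mx e B ->
  V *m B = const_poly_mx (map_mx (mcoeff 0%MM) V) *m B.
Proof.
move=> Ae Be.
apply/matrixP => i j; apply/mpolyP => v; rewrite mxE [in RHS]mxE !raddf_sum.
have [ve|ve] := eqVneq (mdeg v) e.
  apply: eq_bigr => l _; rewrite /= (mcoeffM_homog _ (Be _ _) ve) !mxE.
  by rewrite mul_mpolyC mcoeffZ.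
have := dhomog_nemf_coeff (Ae i j) ve; rewrite mxE raddf_sum => ->.
rewrite big1 // => l _; rewrite !mxE /= mul_mpolyC mcoeffZ.
by rewrite (dhomog_nemf_coeff (Be _ _) ve) mulr0.
Qed.

End HomogeneousMatrices.

(** * Linear quotients *)

Section LinearQuotients.

Variables (k : fieldType) (n : nat).
Implicit Types (s : seq 'X_{1..n}) (w : 'X_{1..n}).

(** The colon ideal of the ideal of s by w is spanned by the quotients
    z / gcd (z, w); it is generated by variables when each of them is a multiple
    of a variable that itself lies in the colon ideal. *)
Definition linear_colon s w :=
  forall z, z \in s -> exists l,
    (w l < z l)%N /\ exists2 y, y \in s & (y <= U_(l) + w)%MM.

Lemma colon_msuppP s w f :
  colon_ideal (@mon_ideal k n (fun z => z \in s)) w f <->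
  forall v, v \in msupp f -> exists2 z, z \in s & (z <= v + w)%MM.
Proof.
rewrite /colon_ideal mon_ideal_msuppP; split=> fs v.
  by move=> vf; apply: fs; rewrite (perm_mem (msuppMX _ _)) addmC map_f.
by rewrite (perm_mem (msuppMX _ _)) => /mapP[z /fs[y ys yz] ->];
  exists y; rewrite // addmC.
Qed.

Lemma linear_colonP s w :
  (exists V : {set 'I_n}, forall f : {mpoly k[n]},
     colon_ideal (mon_ideal (fun z => z \in s)) w f <->
     ideal_gen (fun g => exists2 l, l \in V & g = 'X_l) f) <->
  linear_colon s w.
Proof.
split=> [[V colonV] z zs|lin].
  have /colonV/variable_ideal_msuppP colon_z :
      colon_ideal (@mon_ideal k n (fun y => y \in s)) w 'X_[z - w].
    apply/colon_msuppP => v; rewrite msuppX inE => /eqP->.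
    by exists z => //; apply/mnm_lepP => i; rewrite mnmDE mnmBE; lia.
  have [|l lV] := colon_z (z - w)%MM; first by rewrite msuppX mem_head.
  rewrite mnmBE subn_gt0 => wl; exists l; split=> //.
  have /colonV/colon_msuppP colon_l :
      ideal_gen (fun g => exists2 l, l \in V & g = 'X_l) ('X_l : {mpoly k[n]}).
    apply/variable_ideal_msuppP => v; rewrite msuppX inE => /eqP->.
    by exists l; rewrite // mnm1E eqxx.
  by apply: (colon_l U_(l)%MM); rewrite msuppX mem_head.
exists [set l | has (fun y : 'X_{1..n} => (y <= U_(l) + w)%MM) s] => f.
rewrite colon_msuppP variable_ideal_msuppP; split=> fV v /fV.
  case=> z zs /mnm_lepP zv; have [l [wl [y ys yw]]] := lin z zs.
  exists l; first by rewrite inE; apply/hasP; exists y.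
  by have := zv l; rewrite mnmDE; lia.
case=> l; rewrite inE => /hasP[y ys /mnm_lepP yw] vl; exists y => //.
apply/mnm_lepP => i; apply: leq_trans (yw i) _; rewrite !mnmDE leq_add2r mnm1E.
by case: eqP => // <-.
Qed.

Lemma has_linear_quotientsP (I : {mpoly k[n]} -> Prop) :
  has_linear_quotients I <->
  exists v, [/\ uniq v, forall w, mon_gens I w <-> w \in v &
    forall i, (i < size v)%N -> linear_colon (take i v) (nth 0%MM v i)].
Proof.
split=> -[v [uv vG lin]]; exists v; split=> // i.
  by case: i => [|i] iv; [rewrite take0 | apply/linear_colonP/lin].
by case/andP=> _ iv; apply/linear_colonP/lin.
Qed.

(** Listing the generators divisible by the shedding variable l before the other
    ones keeps colon ideals linear: for a generator u not divisible by l, the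
    generators divisible by l contribute exactly l. *)
Lemma variable_decomposable_linear_quotients (I : {mpoly k[n]} -> Prop) :
  variable_decomposable I -> has_linear_quotients I.
Proof.
move=> vd; apply/has_linear_quotientsP.
elim: vd => {I} [I [w wG]|I l _ shed _ [v [uv vG vlin]] _ [t [ut tG tlin]]].
  exists [:: w]; split=> //; first by move=> v; rewrite inE wG (rwP eqP).
  by case.
exists (t ++ v); split.
- rewrite cat_uniq ut uv andbT; apply/hasPn => w wv.
  have [_ wl] := (mon_gens_without _ _ _).1 ((vG w).2 wv).
  by apply: contra wl => /tG /mon_gens_with[].
- move=> w; rewrite mem_cat; split=> [Gw|].
    apply/orP; case wl: (U_(l) <= w)%MM; [left; apply/tG | right; apply/vG].
      by apply/mon_gens_with.
    by apply/mon_gens_without; rewrite wl.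
  by case/orP => [/tG /mon_gens_with[]|/vG /mon_gens_without[]].
move=> i; rewrite size_cat nth_cat take_cat.
case: (ltnP i (size t)) => [it _|ti iv].
  exact: tlin.
have {}iv : (i - size t < size v)%N by lia.
move=> z; rewrite mem_cat => /orP[zt|zv]; last first.
  have [l' [wl [y ys yw]]] := vlin _ iv z zv.
  by exists l'; split=> //; exists y => //; rewrite mem_cat ys orbT.
set w := nth _ _ _.
have Gw : mon_gens (ideal_without I l) w by apply/vG; rewrite mem_nth.
exists l; split.
  have [_] := (mon_gens_without _ _ _).1 Gw; rewrite lep1mP negbK => /eqP->.
  by have [_] := (mon_gens_with _ _ _).1 ((tG z).2 zt); rewrite lep1mP lt0n.
have [y Gy yE] := shed _ Gw; exists y; first by rewrite mem_cat (tG y).1.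
apply/mnm_lepP => i'; rewrite -yE mnmDE mnmBE mnmE; lia.
Qed.

End LinearQuotients.

(** * The cycle graph *)

Section CyclicSuccessor.

Variable m : nat.
Implicit Types i j : 'I_m.

Lemma ordS_cases i :
  (i.+1 = m /\ ordS i = 0 :> nat) \/ ((i.+1 < m)%N /\ ordS i = i.+1 :> nat).
Proof.
have := ltn_ord i; rewrite leq_eqVlt => /predU1P[im|im]; [left|right].
  by rewrite /= {2}im modnn.
by rewrite /= modn_small.
Qed.

Lemma ordS_neq i : (1 < m)%N -> ordS i != i.
Proof.
move=> m1; apply/eqP => /(congr1 (@nat_of_ord m)).
by have := ordS_cases i; lia.
Qed.

Lemma ordS2_neq i : (2 < m)%N -> ordS (ordS i) != i.
Proof.
move=> m2; apply/eqP => /(congr1 (@nat_of_ord m)).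
by have := ordS_cases i; have := ordS_cases (ordS i); lia.
Qed.

Lemma ord_pred_neq i : (1 < m)%N -> ord_pred i != i.
Proof. by rewrite -{2}[i]ord_predK eq_sym; apply: ordS_neq. Qed.

Lemma ord_pred2_neq i : (2 < m)%N -> ord_pred (ord_pred i) != i.
Proof.
by rewrite -{2}[i]ord_predK -{2}[ord_pred i]ord_predK eq_sym; apply: ordS2_neq.
Qed.

Lemma val_iter_ordS t i : iter t (@ordS m) i = ((i + t) %% m)%N :> nat.
Proof.
elim: t => [|t IHt]; first by rewrite addn0 modn_small.
by rewrite iterS /= IHt -[in LHS]addn1 modnDml addn1 addnS.
Qed.

Lemma iter_ordS_neq t i : (0 < t < m)%N -> iter t (@ordS m) i != i.
Proof.
move=> /andP[t0 tm].
rewrite -[_ == _]/(iter t (@ordS m) i == i :> nat) val_iter_ordS.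
have im := ltn_ord i; apply/eqP.
have [lt|ge] := ltnP (i + t)%N m; first by rewrite modn_small //; lia.
rewrite -[in X in (X %% _)%N](subnK ge) modnDr modn_small; lia.
Qed.

Lemma iter_ordS_onto i j : exists2 t, (t < m)%N & j = iter t (@ordS m) i.
Proof.
have im := ltn_ord i; have jm := ltn_ord j.
exists ((j + (m - i)) %% m)%N; first by rewrite ltn_mod; lia.
apply/val_inj; rewrite /= val_iter_ordS modnDmr.
by rewrite (_ : i + _ = j + m)%N ?modnDr ?modn_small //; lia.
Qed.

Lemma ordS_ind (P : 'I_m -> Prop) i :
  P i -> (forall j, P j -> P (ordS j)) -> forall j, P j.
Proof.
move=> Pi PS j; have [t _ ->] := iter_ordS_onto i j.
by elim: t => //= t; apply: PS.
Qed.

Lemma cycle_adj_triangle_free i j l : (3 < m)%N -> i <> j -> j <> l -> i <> l ->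
  cycle_adj i j -> cycle_adj j l -> cycle_adj i l -> False.
Proof.
move=> m4 ij jl il; have im := ltn_ord i; have jm := ltn_ord j.
have lm := ltn_ord l.
have E x y : x = y :> 'I_m <-> x = y :> nat by split=> [->|/val_inj].
have := ordS_cases i; have := ordS_cases j; have := ordS_cases l.
by move: ij jl il; rewrite /cycle_adj !E; lia.
Qed.

(** Counting, for each vertex, its neighbours of smaller rank counts each of
    the m edges once. If every vertex but one has such a neighbour, there is
    room for a single vertex with two of them. *)
Lemma unique_peak (r : 'I_m -> nat) (first last j : 'I_m) :
  injective r -> (1 < m)%N ->
  (forall i, i != first -> (r (ordS i) < r i)%N || (r (ord_pred i) < r i)%N) ->
  (forall i, i != last -> (r i < r last)%N) ->
  j != last -> (r (ordS j) < r j)%N -> (r (ord_pred j) < r j)%N -> False.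
Proof.
move=> r_inj m1 climb top jl up_j down_j.
pose deg i := ((r (ordS i) < r i) + (r (ord_pred i) < r i))%N.
have sum_deg : (\sum_i deg i = m)%N.
  rewrite big_split /= [X in (_ + X)%N](reindex _ (onW_bij _ (ordS_bij m))) /=.
  rewrite -big_split -[RHS]card_ord -sum1_card; apply: eq_bigr => i _ /=.
  rewrite ordSK; have : r (ordS i) <> r i by move/r_inj; apply/eqP/ordS_neq.
  by lia.
have : (\sum_i ((i != first) + ((i == last) + (i == j))) <= \sum_i deg i)%N.
  apply: leq_sum => i _; rewrite /deg.
  have [->|il] := eqVneq i last.
    rewrite (eq_sym last j) (negPf jl) !top ?ord_pred_neq ?ordS_neq //.
    by case: (_ != _).
  have [->|ij] := eqVneq i j; first by rewrite up_j down_j; case: (_ != _).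
  by have [//|/climb] := eqVneq i first; lia.
have sum1 (l : 'I_m) : (\sum_i (i == l) = 1)%N.
  by rewrite (bigD1 l) //= eqxx big1 // => i /negPf->.
have := cardC1 first; rewrite card_ord -sum1_card big_mkcond /=.
rewrite sum_deg !big_split /= !sum1 => cardC.
rewrite (eq_bigr (fun i => if predC1 first i then 1 else 0)%N) => [|i _].
  by rewrite cardC; lia.
by rewrite /=; case: (_ == _).
Qed.

End CyclicSuccessor.

(** * Squarefree generators forming a cycle *)

Section CyclicGenerators.

Variables (n m d : nat) (u : 'I_m -> 'X_{1..n}).
Hypothesis u_squarefree : forall j, squarefree (u j).
Hypothesis u_deg : forall j, mdeg (u j) = d.
Hypothesis u_inj : injective u.
Hypothesis m_gt3 : (3 < m)%N.
Hypothesis u_cycle : forall i j, lin_adj (u i) (u j) <-> cycle_adj i j.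

(** Passing from u_j to u_(j+1), the variable b_j is gained and a_j is lost. *)
Variables a b : 'I_m -> 'I_n.
Hypothesis ab_edge : forall j, (U_(b j) + u j)%MM = (U_(a j) + u (ordS j))%MM.

Definition missing j := [set x | u j x == 0%N].

Lemma u_missing j x : u j x = (x \notin missing j).
Proof. by rewrite inE; have := u_squarefree j x; case: (u j x) => [|[]]. Qed.

Lemma missing_div j x : (x \in missing j) = ~~ (U_(x) <= u j)%MM.
Proof. by rewrite lep1mP negbK inE. Qed.

Lemma card_missing j : (#|missing j| + d = n)%N.
Proof.
rewrite -[RHS]card_ord -[RHS](cardsC (missing j)); congr (_ + _)%N.
rewrite -(u_deg j) mdegE -sum1_card [RHS]big_mkcond; apply: eq_bigr => x _.
by rewrite u_missing in_setC; case: ifP.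
Qed.

Lemma ab_edgeE j x : ((b j == x) + u j x = (a j == x) + u (ordS j) x)%N.
Proof. by have /mnmP/(_ x) := ab_edge j; rewrite !mnmDE !mnm1E. Qed.

Lemma a_neq_b j : a j != b j.
Proof.
apply: contraTneq (ordS_neq j (ltnW (ltnW m_gt3))) => ab; rewrite negbK.
by apply/eqP/u_inj/mnmP => x; have := ab_edgeE j x; rewrite ab; lia.
Qed.

Lemma b_missing j : b j \in missing j.
Proof.
have := ab_edgeE j (b j); have := u_squarefree (ordS j) (b j).
by rewrite inE eqxx (negPf (a_neq_b j)); lia.
Qed.

Lemma b_notin_missing j : b j \notin missing (ordS j).
Proof.
by have := ab_edgeE j (b j); rewrite inE eqxx (negPf (a_neq_b j)); lia.
Qed.

Lemma a_missing j : a j \in missing (ordS j).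
Proof.
have := ab_edgeE j (a j); have := u_squarefree j (a j).
by rewrite inE eqxx eq_sym (negPf (a_neq_b j)); lia.
Qed.

Lemma missing_ordS j x : x \in missing (ordS j) -> x = a j \/ x \in missing j.
Proof.
rewrite !inE => /eqP ux; have := ab_edgeE j x; rewrite ux addn0.
case: (eqVneq (a j) x) => [->|ax] ?; first by left.
by right; lia.
Qed.

(** If the variable lost at one step came back at the next one, u_j and u_(j+2)
    would be adjacent, against m > 3. *)
Lemma a_neq_b_ordS j : a j != b (ordS j).
Proof.
have S1 i := elimN eqP (ordS_neq i (ltnW (ltnW m_gt3))).
have S2 := elimN eqP (ordS2_neq j (ltnW m_gt3)).
apply/eqP => ab.
apply: (@cycle_adj_triangle_free m (ordS (ordS j)) (ordS j) j) => //;
  try by right.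
apply/u_cycle; split; first by move/u_inj.
exists (a (ordS j)), (b j); apply/mnmP => x.
have := ab_edgeE j x; have := ab_edgeE (ordS j) x.
by rewrite ab !mnmDE !mnm1E; lia.
Qed.

(** The variable lost before u_j and the one gained after it are missing. *)
Lemma card_missing_ge2 j : (1 < #|missing j|)%N.
Proof.
rewrite -(ord_predK j) (cardD1 (a (ord_pred j))) a_missing.
rewrite (cardD1 (b (ordS (ord_pred j)))) !inE eq_sym a_neq_b_ordS /=.
by have := b_missing (ordS (ord_pred j)); rewrite inE => ->.
Qed.

Lemma edge_quotient j : (u (ordS j) - mgcd (u j) (u (ordS j)))%MM = U_(b j)%MM.
Proof.
apply/mnmP => x; rewrite mnmBE mnmE mnm1E.
have := ab_edgeE j x; have := a_neq_b j.
have := u_squarefree j x; have := u_squarefree (ordS j) x.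
by case: (eqVneq (b j) x) => [->|_]; case: (eqVneq (a j) x) => //=; lia.
Qed.

Lemma edge_quotient_rev j :
  (u j - mgcd (u (ordS j)) (u j))%MM = U_(a j)%MM.
Proof.
apply/mnmP => x; rewrite mnmBE mnmE mnm1E.
have := ab_edgeE j x; have := a_neq_b j.
have := u_squarefree j x; have := u_squarefree (ordS j) x.
by case: (eqVneq (b j) x) => [->|_]; case: (eqVneq (a j) x) => //=; lia.
Qed.

(** All generators have the same degree, so this divisibility makes u_i and u_j
    adjacent; the exponents in the edge relation then determine l. *)
Lemma edge_of_le i j l : (u i <= U_(l) + u j)%MM -> i <> j ->
  (i = ordS j /\ l = b j) \/ (j = ordS i /\ l = a i).
Proof.
move=> uij ij; have := submK uij; set w := (_ - _)%MM => wE.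
have : mdeg w = 1%N.
  by have := congr1 mdeg wE; rewrite !mdegD mdeg1 !u_deg; lia.
move/eqP; rewrite mdeg_eq1 => /existsP[y /eqP yE]; rewrite {}yE in wE.
have /u_cycle [ji|ji] : lin_adj (u i) (u j).
- by split=> [/u_inj//|]; exists y, l.
- right; split=> //; apply/eqP; move: wE; rewrite ji => /mnmP/(_ (a i)).
  have := ab_edgeE i (a i); rewrite !mnmDE !mnm1E eqxx (eq_sym (b i)).
  by rewrite (negPf (a_neq_b i)); case: (l == a i) => //; lia.
left; split=> //; apply/eqP; move: wE; rewrite ji => /mnmP/(_ (b j)).
have := ab_edgeE j (b j); rewrite !mnmDE !mnm1E eqxx.
by rewrite (negPf (a_neq_b j)); case: (l == b j) => //; lia.
Qed.

(** * Generators that miss two variables *)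

Section TwoMissing.

Hypothesis card_missing2 : forall j, #|missing j| = 2.

Lemma b_ordS_neq j : b (ordS j) != b j.
Proof.
by apply: contraTneq (b_missing (ordS j)) => ->; apply: b_notin_missing.
Qed.

(** The variable b_(j+1), missing from u_(j+1), differs from the variable a_j
    lost just before, so it was already missing from u_j. *)
Lemma missingE j : missing j = [set b j; b (ordS j)].
Proof.
apply/esym/eqP; rewrite eqEcard cards2 eq_sym b_ordS_neq card_missing2 andbT.
apply/subsetP => x; rewrite in_set2 => /orP[]/eqP->; first exact: b_missing.
have [/esym/eqP|//] := missing_ordS (b_missing (ordS j)).
by rewrite (negPf (a_neq_b_ordS j)).
Qed.

Lemma a_def j : a j = b (ordS (ordS j)).
Proof.
have := a_missing j; rewrite missingE in_set2 (negPf (a_neq_b_ordS j)).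
by move/eqP.
Qed.

Lemma adj_of_missing i j x : i <> j -> x \in missing i -> x \in missing j ->
  cycle_adj i j.
Proof.
have other l : x \in missing l -> exists2 y, y != x & missing l = [set x; y].
  rewrite missingE in_set2 => /orP[]/eqP->; last first.
    by exists (b l); rewrite 1?setUC // eq_sym b_ordS_neq.
  by exists (b (ordS l)); rewrite // b_ordS_neq.
move=> ij /other[y yx iE] /other[z zx jE]; apply/u_cycle; split.
  by move/u_inj.
exists y, z; apply/mnmP => t; rewrite !mnmDE !mnm1E !u_missing iE jE !in_set2.
have [->|tx] := eqVneq t x; first by rewrite (negPf yx) (negPf zx).
by rewrite /= [t == y]eq_sym [t == z]eq_sym; case: eqP; case: eqP.
Qed.

Lemma missing_at_most_twice i j l x : i <> j -> j <> l -> i <> l ->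
  x \in missing i -> x \in missing j -> x \in missing l -> False.
Proof.
move=> ij jl il xi xj xl.
apply: (cycle_adj_triangle_free m_gt3 ij jl il).
- exact: (adj_of_missing ij xi xj).
- exact: (adj_of_missing jl xj xl).
exact: (adj_of_missing il xi xl).
Qed.

Lemma b_missing_pred j : b j \in missing (ord_pred j).
Proof. by rewrite missingE ord_predK in_set2 eqxx orbT. Qed.

(** A coincidence b_i = b_j would make this variable missing from three of the
    generators of indices i, i - 1, j, j - 1. *)
Lemma b_inj : injective b.
Proof.
move=> i j bij; apply/eqP/negPn/negP => /eqP ij.
have pred_neq (l : 'I_m) : ord_pred l <> l by apply/eqP/ord_pred_neq; lia.
have bi := b_missing i; have bj := b_missing j.
have [pij|/eqP pij] := eqVneq (ord_pred i) j; last first.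
  apply: (missing_at_most_twice (@pred_neq i) ij pij _ bi).
    exact: b_missing_pred.
  by rewrite bij.
apply: (@missing_at_most_twice (ord_pred j) j i (b j)) => //.
- by move=> ji; apply: ij.
- by apply/eqP; rewrite -pij ord_pred2_neq //; lia.
- exact: b_missing_pred.
- by rewrite -bij.
Qed.

Lemma cyclic_labelling : (forall x, exists j, x \in missing j) ->
  exists (e : m = n) (s : 'S_n), forall i j : 'I_m,
    i <> j -> ordS i <> j -> (U_(s (cast_ord e i)) <= u j)%MM.
Proof.
move=> miss.
have b_onto x : x \in codom b.
  have [j] := miss x; rewrite missingE in_set2.
  by case/orP=> /eqP->; apply: codom_f.
have e : m = n.
  have /eq_card : codom b =i predT by move=> x; rewrite b_onto.
  by rewrite (card_codom b_inj) !card_ord.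
(* b_j and b_(j+1), missing from u_j, must get the labels j - 1 and j *)
pose f x := b (ordS (cast_ord (esym e) x)).
have f_inj : injective f by move=> x y /b_inj/ordS_inj/cast_ord_inj.
exists e, (perm f_inj) => i j ij Sij; rewrite permE /f cast_ordK.
apply: contraPT isT; rewrite -missing_div missingE in_set2 => /orP[]/eqP/b_inj.
  by move/Sij.
by move/ordS_inj.
Qed.

(** In an arc starting at u_j, the variable b_j is missing from u_j only, and
    u_(j+1) / gcd(u_j, u_(j+1)) = b_j: shedding it leaves u_j alone on one side,
    and a shorter arc on the other one. *)
Lemma arc_variable_decomposable (k : fieldType) t j (I : {mpoly k[n]} -> Prop) :
  (t.+1 < m)%N ->
  (forall w, mon_gens I w <-> w \in map u (traject (@ordS m) j t.+1)) ->
  variable_decomposable I.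
Proof.
elim: t j I => [|t IHt] j I tm IG.
  by apply: VarDecSingle; exists (u j) => v; rewrite IG inE (rwP eqP).
have div_bj i : i \in traject (@ordS m) (ordS j) t.+1 -> (U_(b j) <= u i)%MM.
  move=> /trajectP[p pt ->]; apply: contraTT isT; rewrite -missing_div missingE.
  rewrite -iterSr in_set2 !(inj_eq b_inj) => /orP[]/eqP/esym/eqP.
    by rewrite (negPf (iter_ordS_neq _ _)) //; lia.
  by rewrite -iterS (negPf (iter_ordS_neq _ _)) //; lia.
have ndiv_bj : ~~ (U_(b j) <= u j)%MM by rewrite -missing_div b_missing.
have without w : mon_gens (ideal_without I (b j)) w <-> w = u j.
  rewrite mon_gens_without IG; split=> [[]|->]; last by rewrite mem_head.
  by rewrite trajectS map_cons in_cons => /predU1P[//|/mapP[i it ->]];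
    rewrite div_bj.
have with_ w : mon_gens (ideal_with I (b j)) w <->
    w \in map u (traject (@ordS m) (ordS j) t.+1).
  rewrite mon_gens_with IG; split=> [[]|wt]; last first.
    split; first by rewrite trajectS map_cons in_cons wt orbT.
    by have /mapP[i it ->] := wt; apply: div_bj.
  rewrite trajectS map_cons in_cons => /predU1P[->|//].
  by rewrite (negPf ndiv_bj).
apply: (VarDecStep (l := b j)).
- exists 'X_[u j]; last exact: mpolyX_neq0.
  by have /without[] : u j = u j by [].
- move=> w /without->; exists (u (ordS j)); first by apply/with_/mem_head.
  exact: edge_quotient.
- by apply: VarDecSingle; exists (u j).
- exact: IHt (ltnW tm) with_.
Qed.

(** The variable b_j is missing from u_(j-1) and u_j only. They form one arc,
    the other generators form another one, and u_(j-2) and u_(j+1) are obtained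
    from them by gaining b_j. *)
Lemma cycle_variable_decomposable (k : fieldType) (I : {mpoly k[n]} -> Prop) :
  (forall w, mon_gens I w <-> exists j, w = u j) -> variable_decomposable I.
Proof.
move=> IG; have m0 : (0 < m)%N by lia.
pose j := Ordinal m0; pose i := ord_pred j.
have div_bj l : (U_(b j) <= u l)%MM = ((l != i) && (l != j)).
  rewrite -[LHS]negbK -missing_div missingE in_set2 !(inj_eq b_inj) negb_or.
  rewrite andbC.
  by rewrite -(inj_eq (@ord_pred_inj m)) ordSK eq_sym [j == l]eq_sym.
have without w : mon_gens (ideal_without I (b j)) w <->
    w \in map u (traject (@ordS m) i 2).
  rewrite mon_gens_without IG /= !inE ord_predK; split.
    by case=> -[l ->]; rewrite div_bj negb_and !negbK !(inj_eq u_inj).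
  by case/orP=> /eqP->; rewrite div_bj eqxx ?andbF; split=> //;
    [exists i | exists j].
have with_ w : mon_gens (ideal_with I (b j)) w <->
    exists2 l, (l != i) && (l != j) & w = u l.
  rewrite mon_gens_with IG; split=> [[[l ->]]|[l lij ->]].
    by rewrite div_bj; exists l.
  by rewrite div_bj; split; first exists l.
apply: (VarDecStep (l := b j)).
- exists 'X_[u j]; last exact: mpolyX_neq0.
  apply/mon_ideal_mem; exists (u j); rewrite ?lepm_refl // IG div_bj eqxx andbF.
  by split; first exists j.
- move=> w /without; rewrite /= ord_predK !inE => /orP[]/eqP->.
    exists (u (ord_pred i)).
      apply/with_; exists (ord_pred i) => //.
      rewrite ord_pred_neq ?ord_pred2_neq //; lia.
    by have := edge_quotient_rev (ord_pred i); rewrite a_def !ord_predK.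
  exists (u (ordS j)); last exact: edge_quotient.
  apply/with_; exists (ordS j) => //; rewrite ordS_neq ?andbT; last by lia.
  by rewrite -(inj_eq (@ordS_inj m)) ord_predK ordS2_neq //; lia.
- by apply: arc_variable_decomposable without; lia.
apply: (@arc_variable_decomposable k (m - 3) (ordS j)); first by lia.
move=> w; rewrite with_.
split=> [[l /andP[li lj] ->]|/mapP[l /trajectP[t tm ->] ->]].
  rewrite (mem_map u_inj); apply/trajectP.
  have [[|t] tm lE] := iter_ordS_onto j l; first by rewrite lE eqxx in lj.
  exists t; last by rewrite -iterSr.
  suff : t.+2 != m by lia.
  apply: contraNneq li => tE; rewrite /i -(inj_eq (@ordS_inj m)) ord_predK lE.
  by rewrite -iterS tE -val_eqE /= val_iter_ordS modnDr modn_small.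
eexists; last by [].
rewrite -iterSr -(inj_eq (@ordS_inj m)) ord_predK -iterS.
by rewrite !iter_ordS_neq //; lia.
Qed.

End TwoMissing.

Lemma card_missing_of_labelling (s : 'I_m -> 'I_n) :
  (forall x, exists i, x = s i) ->
  (forall i j, i <> j -> ordS i <> j -> (U_(s i) <= u j)%MM) ->
  forall j, #|missing j| = 2.
Proof.
move=> s_onto s_div j; apply/eqP; rewrite eqn_leq card_missing_ge2 andbT.
apply: leq_trans (_ : (#|[set s j; s (ord_pred j)]| <= 2)%N); last first.
  by rewrite cards2; case: eqP.
apply/subset_leq_card/subsetP => x; have [i ->] := s_onto x.
rewrite missing_div in_set2; have [->|ij] := eqVneq i j; first by rewrite eqxx.
have [<-|Sij] := eqVneq (ordS i) j; first by rewrite ordSK eqxx orbT.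
by rewrite s_div //; apply/eqP.
Qed.

(** * Linear quotients of a cycle *)

(** A variable that is never lost along the cycle divides every generator if it
    divides one of them. *)
Lemma a_onto : (forall x, exists j, x \in missing j) ->
  (forall x, exists j, x \notin missing j) -> forall x, x \in codom a.
Proof.
move=> miss hit x; apply/negPn/negP => xa.
have [i xi] := hit x; have [j xj] := miss x.
suff /(_ j) : forall l, x \notin missing l by rewrite xj.
apply: ordS_ind xi _ => l; apply: contra => /missing_ordS[xE|//].
by rewrite xE codom_f in xa.
Qed.

Lemma generators_ge_variables : (forall x, exists j, x \in missing j) ->
  (forall x, exists j, x \notin missing j) -> (n <= m)%N.
Proof.
move=> miss hit; rewrite -[X in (X <= _)%N]card_ord -[X in (_ <= X)%N]card_ord.
apply: leq_trans (leq_image_card a predT).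
by apply/subset_leq_card/subsetP => x _; apply: a_onto.
Qed.

(** Order the generators with linear quotients. Only the last one is preceded by
    its two neighbours, so each colon ideal in between is generated by a single
    variable, which is missing from the generator added and divides all previous
    ones. These m - 2 variables are distinct and divide the first generator,
    whence d >= m - 2 >= n - 2. *)
Lemma linear_quotients_card_missing (k : fieldType) (I : {mpoly k[n]} -> Prop) :
  (forall x, exists j, x \in missing j) ->
  (forall x, exists j, x \notin missing j) ->
  (forall w, mon_gens I w <-> exists j, w = u j) ->
  has_linear_quotients I -> forall j, #|missing j| = 2.
Proof.
move=> miss hit IG /has_linear_quotientsP[v [uv vG lin]].
have nm := generators_ge_variables miss hit.
have uv_in j : u j \in v by apply/vG/IG; exists j.
have vE : v =i map u (enum 'I_m).
  move=> w; apply/idP/mapP => [/vG/IG[j ->]|[j _ ->]]; last exact: uv_in.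
  by exists j; rewrite ?mem_enum.
have sv : size v = m.
  have uE : uniq (map u (enum 'I_m)) by rewrite map_inj_uniq ?enum_uniq.
  by rewrite (perm_size (uniq_perm uv uE vE)) size_map size_enum_ord.
pose r j := index (u j) v.
have rm j : (r j < m)%N by rewrite -sv index_mem.
have r_inj : injective r.
  by move=> i j /(congr1 (nth 0%MM v)); rewrite !nth_index // => /u_inj.
have r_onto t : (t < m)%N -> exists j, r j = t.
  move=> tm; have /vG/IG[j jE] : nth 0%MM v t \in v by rewrite mem_nth ?sv.
  by exists j; rewrite /r -jE index_uniq ?sv.
have [first r_first] : exists j, r j = 0%N by apply: r_onto; lia.
have r_pos i : i != first -> (r first < r i)%N.
  by rewrite r_first lt0n -r_first (inj_eq r_inj).
have [last r_last] : exists j, r j = m.-1 by apply: r_onto; lia.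
(* linearity of the colon ideal by u_j, applied to the earlier generator u_i *)
have colon j i : (r i < r j)%N -> exists l,
    [/\ l \in missing j, l \notin missing i
    & (r (ordS j) < r j)%N /\ l = b j \/
      (r (ord_pred j) < r j)%N /\ l = a (ord_pred j)].
  have before w : w \in take (r j) v -> exists2 i', w = u i' & (r i' < r j)%N.
    move=> wt; have /vG/IG[i' wE] := mem_take wt; exists i' => //.
    by move: wt; rewrite wE in_take ?uv_in.
  move=> rij; have jv : (r j < size v)%N by rewrite sv.
  have [|l [lij [w /before[i' -> ri'] le_i']]] := lin _ jv (u i).
    by rewrite in_take ?uv_in.
  move: lij le_i'; rewrite nth_index // => lij le_i'.
  have sq := u_squarefree i l.
  exists l; split; [by rewrite inE; lia | by rewrite inE; lia |].
  have ij : i' <> j by move=> ij; rewrite ij ltnn in ri'.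
  have [[iE ->]|[jE ->]] := edge_of_le le_i' ij; first by left; rewrite -iE.
  by right; rewrite jE ordSK -jE.
have one_neighbour j : j != last ->
    (r (ordS j) < r j)%N -> (r (ord_pred j) < r j)%N -> False.
  apply: (unique_peak (first := first)) (r_inj) _ _ _ => [|i ifi|i il].
  - by lia.
  - have [l [_ _ [[->]|[->]]]//] := colon i first (r_pos i ifi).
    by rewrite orbT.
  rewrite r_last; have := rm i; suff : r i <> r last by lia.
  by move/r_inj/eqP; rewrite (negPf il).
(* the generator of the colon ideal by u_j, unless u_j is first or last *)
pose x j := if (r (ordS j) < r j)%N then b j else a (ord_pred j).
have x_colon i j : j != last -> (r i < r j)%N ->
    x j \in missing j /\ x j \notin missing i.
  move=> jl /colon[l [lj li cases]]; suff -> : x j = l by [].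
  rewrite /x; case: cases => -[rlt ->]; first by rewrite rlt.
  by case: ifP => // up; have := one_neighbour _ jl up rlt.
have x_inj : {in [set~ last] :\ first &, injective x}.
  have sep i j : j != last -> i != last -> i != first -> (r i < r j)%N ->
      x i != x j.
    move=> jl il ifi rij; have [_] := x_colon _ _ jl rij.
    have [xi _] := x_colon first i il (r_pos i ifi).
    by apply: contraNneq => <-.
  move=> i j; rewrite !inE => /andP[ifi il] /andP[jf jl] xij.
  case: (ltngtP (r i) (r j)) => [rij|rji|/r_inj//].
    by have := sep _ _ jl il ifi rij; rewrite xij eqxx.
  by have := sep _ _ il jl jf rji; rewrite xij eqxx.
have : (#|x @: ([set~ last] :\ first)| <= #|~: missing first|)%N.
  apply/subset_leq_card/subsetP => _ /imsetP[j + ->].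
  rewrite !inE => /andP[jf jl]; have [_] := x_colon first j jl (r_pos j jf).
  by rewrite inE.
have first_last : first != last.
  by rewrite -(inj_eq r_inj) r_first r_last; lia.
rewrite card_in_imset // => cardJ j.
have := cardsD1 first [set~ last]; rewrite cardsC1 card_ord !inE first_last.
have := cardsC (missing first); rewrite card_ord.
have := card_missing j; have := card_missing first; have := card_missing_ge2 j.
by move: cardJ nm; lia.
Qed.

(** * Syzygies *)

Section Syzygies.

Variable k : fieldType.
Let full := [multinom 1%N | x < n].

Definition generators : 'cV[{mpoly k[n]}]_m := \col_j 'X_[u j].

Definition edge_syzygies : 'M[{mpoly k[n]}]_m :=
  \matrix_(j, i) ('X_(b j) *+ (i == j) - 'X_(a j) *+ (i == ordS j)).

(** Going around the cycle, the relations b_j u_j = a_j u_(j+1) compose to a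
    trivial one; with these coefficients all of them are multiplied up to the
    product of all variables. *)
Definition cycle_syzygy : 'rV[{mpoly k[n]}]_m :=
  \row_j 'X_[full - (U_(b j) + u j)].

Lemma edge_le_full j : (U_(b j) + u j <= full)%MM.
Proof.
apply/mnm_lepP => x; rewrite mnmDE mnm1E mnmE.
have := u_squarefree j x; have := b_missing j; rewrite inE.
by case: (eqVneq (b j) x) => [<-|_]; lia.
Qed.

Lemma mul_edge_syzygies (z : 'rV_m) i :
  (z *m edge_syzygies) 0 (ordS i) =
    z 0 (ordS i) * 'X_(b (ordS i)) - z 0 i * 'X_(a i).
Proof.
have Si : i != ordS i by rewrite eq_sym ordS_neq //; lia.
rewrite mxE (bigD1 (ordS i)) //= (bigD1 i) //= !mxE eqxx (inj_eq (@ordS_inj m)).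
rewrite [ordS i == i]eq_sym (negPf Si) /= subr0 sub0r mulrN.
rewrite addrA big1 ?addr0 // => j /andP[jS ji].
rewrite mxE (inj_eq (@ordS_inj m)) ![_ == j]eq_sym (negPf jS) (negPf ji).
by rewrite subr0 mulr0.
Qed.

Lemma mul_edge_syzygies_eq0 (z : 'rV_m) : z *m edge_syzygies = 0 <->
  forall i, z 0 (ordS i) * 'X_(b (ordS i)) = z 0 i * 'X_(a i).
Proof.
split=> [z0 i|zE].
  by apply/eqP; rewrite -subr_eq0 -mul_edge_syzygies z0 mxE.
by apply/rowP => i; rewrite -[i]ord_predK mul_edge_syzygies zE subrr mxE.
Qed.

(** The equations say that z_j b_j u_j is the same polynomial for all j; every
    generator divides it, hence so does the product of all variables. *)
Lemma edge_syzygies_kernel (z : 'rV_m) :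
  (forall x, exists j, x \notin missing j) ->
  z *m edge_syzygies = 0 <-> exists g, z = g *: cycle_syzygy.
Proof.
move=> hit; rewrite mul_edge_syzygies_eq0; split=> [zE|[g ->] i]; last first.
  rewrite !mxE -!mulrA -!mpolyXD; congr (_ * 'X_[_]); apply/mnmP => x.
  have /mnm_lepP/(_ x) := edge_le_full i; have := ab_edgeE i x.
  have /mnm_lepP/(_ x) := edge_le_full (ordS i).
  by rewrite !(mnmDE, mnmBE, mnm1E); lia.
have m0 : (0 < m)%N by lia.
pose T j := z 0 j * 'X_[U_(b j) + u j].
have T_const i : forall j, T j = T i.
  apply: ordS_ind (erefl _) _ => j <-.
  by rewrite /T mpolyXD mulrA zE -mulrA -mpolyXD -ab_edge.
pose i0 := Ordinal m0.
have [|g gE] := @mpolyX_factor k n full (T i0).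
  move=> v vT; apply/mnm_lepP => x; rewrite mnmE; have [j xj] := hit x.
  move: vT; rewrite -(T_const i0 j) (perm_mem (msuppMX _ _)) => /mapP[w _ ->].
  by rewrite !mnmDE u_missing xj; lia.
exists g; apply/rowP => j; rewrite !mxE.
apply: (@mulX_inj k n (U_(b j) + u j)%MM); rewrite -/(T j) (T_const i0).
by rewrite gE -mulrA -mpolyXD submK ?edge_le_full.
Qed.

Lemma edge_syzygies_generators : edge_syzygies *m generators = 0.
Proof.
apply/colP => j; have Sj : j != ordS j by rewrite eq_sym ordS_neq //; lia.
rewrite !mxE (bigD1 j) //= (bigD1 (ordS j)) 1?eq_sym //=.
rewrite big1 => [|i /andP[ij iS]].
  rewrite !mxE !eqxx [ordS j == j]eq_sym (negPf Sj) subr0 sub0r addr0 mulNr.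
  by rewrite -!mpolyXD ab_edge subrr.
by rewrite !mxE (negPf ij) (negPf iS) subrr mul0r.
Qed.

(** Comparing coefficients in the multidegree l u_j: besides u_j, only a
    neighbour in the cycle can divide this monomial. *)
Lemma linear_syzygies (z : 'rV[{mpoly k[n]}]_m) :
  (forall j, z 0 j \is 1.-homog) -> z *m generators = 0 ->
  exists e : 'rV[k]_m, z = const_poly_mx n e *m edge_syzygies.
Proof.
move=> z1 z0; exists (\row_j (z 0 j)@_(U_(b j))).
apply/rowP => i; rewrite -[i]ord_predK mul_edge_syzygies.
set j := ord_pred i; rewrite !mxE; apply/mpolyP => v.
rewrite mcoeffB !mul_mpolyC !mcoeffZ !mcoeffX.
have [v1|v1] := eqVneq (mdeg v) 1%N; last first.
  rewrite (dhomog_nemf_coeff (z1 _)) //.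
  have vU x : (U_(x) == v)%MM = false.
    by apply: contraNF v1 => /eqP<-; rewrite mdeg1.
  by rewrite !vU !mulr0 subrr.
have /existsP[l /eqP {v v1}->] : [exists l, v == U_(l)%MM].
  by rewrite -mdeg_eq1 v1.
have eqU x y : (U_(x) == U_(y) :> 'X_{1..n})%MM = (x == y).
  by apply/eqP/eqP => [/mnmP/(_ x)|->//]; rewrite !mnm1E eqxx; case: eqP.
rewrite !eqU.
have [<-|bl] := eqVneq (b (ordS j)) l.
  by rewrite (negPf (a_neq_b_ordS j)) mulr1 mulr0 subr0.
rewrite mulr0 sub0r.
have : (z *m generators) 0 0 = 0 by rewrite z0 mxE.
move/(congr1 (mcoeff (U_(l) + u (ordS j)))).
rewrite mxE raddf_sum mcoeff0 (bigD1 (ordS j)) //=.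
rewrite mxE mcoeffMX_le lem_addl addmK.
have jS : j != ordS j by rewrite eq_sym ordS_neq //; lia.
rewrite (bigD1 j) //= mxE mcoeffMX_le.
rewrite big1 ?addr0 => [|i' /andP[iS ij]]; last first.
  rewrite mxE mcoeffMX_le.
  case: ifP => // /edge_of_le[|[iE lE]|[/ordS_inj iE _]].
  - exact/eqP.
  - by rewrite lE eqxx in bl.
  - by rewrite iE eqxx in ij.
have [al|al] := eqVneq (a j) l.
  have -> : (u j <= U_(l) + u (ordS j))%MM by rewrite -al -ab_edge lem_addl.
  by rewrite -al -ab_edge addmK mulr1 => /eqP; rewrite addr_eq0 => /eqP.
rewrite mulr0 oppr0; case: ifP => [/edge_of_le[|[jE _]|[_ lE]]|_]; last first.
- by rewrite addr0.
- by rewrite lE eqxx in al.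
- by have := ordS2_neq j; rewrite -jE eqxx; lia.
- exact/eqP.
Qed.

Lemma generators_span (I : {mpoly k[n]} -> Prop) :
  squarefree_monomial_ideal I ->
  (forall w, mon_gens I w <-> exists j, w = u j) ->
  forall f, I f <-> exists v : 'rV_m, f = (v *m generators) 0 0.
Proof.
case=> A _ IA IG f; rewrite (mon_gens_generate IA); split=> [[s sG ->]|[v ->]].
  elim: s sG => [|p s IHs] sG.
    by exists 0; rewrite mul0mx mxE big_nil.
  have [|v vE] := IHs; first by move=> q qs; apply: sG; rewrite inE qs orbT.
  have [_ /IG[j ->] pE] := sG p (mem_head _ _).
  exists (p.1 *: delta_mx 0 j + v).
  by rewrite mulmxDl mxE -vE -scalemxAl -rowE !mxE big_cons pE.
rewrite mxE; apply: mon_ideal_sum => j _.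
exists [:: (v 0 j, 'X_[u j])]; last by rewrite big_seq1 mxE.
by move=> p; rewrite inE => /eqP->; exists (u j); rewrite // IG; exists j.
Qed.

Lemma const_mul_generators_inj r (C : 'M[k]_(r, m)) :
  const_poly_mx n C *m generators = 0 -> C = 0.
Proof.
move=> C0; apply/matrixP => i j; rewrite mxE.
have : (const_poly_mx n C *m generators) i 0 = 0 by rewrite C0 mxE.
move/(congr1 (mcoeff (u j))); rewrite mxE raddf_sum mcoeff0 (bigD1 j) //= big1.
  by rewrite addr0 !mxE mul_mpolyC mcoeffZ mcoeffX eqxx mulr1.
move=> l lj; rewrite !mxE mul_mpolyC mcoeffZ mcoeffX.
by rewrite (inj_eq u_inj) (negPf lj) mulr0.
Qed.

Lemma card_missing2_of_le : (n <= d + 2)%N -> forall j, #|missing j| = 2.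
Proof.
by move=> nd j; have := card_missing j; have := card_missing_ge2 j; lia.
Qed.

Lemma mdeg_cycle_syzygy j : mdeg (full - (U_(b j) + u j)) = (n - d.+1)%N.
Proof.
have : mdeg full = n.
  rewrite mdegE (eq_bigr (fun _ => 1%N)) => [|x _]; last by rewrite mnmE.
  by rewrite sum1_card card_ord.
rewrite -{1}(submK (edge_le_full j)) mdegD mdegD mdeg1 u_deg; lia.
Qed.

(** The complex S -> S^m -> S^m given by cycle_syzygy and edge_syzygies is
    mapped to the resolution by V and F, and the start of the resolution is
    mapped back by C and E. The second differential of the resolution is mapped
    to linear rows in the kernel of edge_syzygies; these vanish if n > d + 2, as
    all rows of this kernel are multiples of cycle_syzygy. Then F E annihilates
    cycle_syzygy, although it is the identity modulo this kernel. *)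
Lemma linear_resolution_card_missing (I : {mpoly k[n]} -> Prop) :
  (forall x, exists j, x \notin missing j) ->
  squarefree_monomial_ideal I ->
  (forall w, mon_gens I w <-> exists j, w = u j) ->
  has_linear_resolution I d -> forall j, #|missing j| = 2.
Proof.
move=> hit sqfI IG [R lin]; apply: card_missing2_of_le.
rewrite leqNgt; apply/negP => nd.
have span := generators_span sqfI IG.
have aug_homog : homog_mx d (res_aug R).
  by move=> r c; rewrite (ord1 c) -[d]addn0 -(lin 0%N r); apply: res_aug_homog.
have diff_homog i : homog_mx 1 (res_diff R i).
  move=> r c; have := res_diff_homog r c.
  by rewrite /shift_homog !lin leq_add2l leqnSn subnDl subSnn.
have gens_homog : homog_mx d generators.
  by move=> j c; rewrite mxE dhomogX /= u_deg.
have [V0 V0E] : exists V0 : 'M_(m, _), generators = V0 *m res_aug R.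
  have /fin_all_exists[V VE] j : exists v : 'rV_(res_rank R 0),
      'X_[u j] = (v *m res_aug R) 0 0.
    apply/res_aug_onto/span; exists (delta_mx 0 j).
    by rewrite -rowE !mxE.
  exists (\matrix_j V j); apply/colP => j; rewrite mxE VE !mxE.
  by apply: eq_bigr => l _; rewrite mxE.
have [C0 C0E] : exists C0 : 'M_(_, m), res_aug R = C0 *m generators.
  have /fin_all_exists[C CE] r : exists v : 'rV_m,
      res_aug R r 0 = (v *m generators) 0 0.
    apply/span/res_aug_onto; exists (delta_mx 0 r).
    by rewrite -rowE !mxE.
  exists (\matrix_r C r); apply/colP => r; rewrite CE !mxE.
  by apply: eq_bigr => l _; rewrite mxE.
(* V and C are the base changes between the given generators and those of the
   resolution *)
have [V VE] : exists V, generators = const_poly_mx n V *m res_aug R.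
  by eexists; rewrite {1}V0E; apply: homog_mx_factor; rewrite -?V0E.
have [C CE] : exists C, res_aug R = const_poly_mx n C *m generators.
  by eexists; rewrite {1}C0E; apply: homog_mx_factor; rewrite -?C0E.
have VC1 : const_poly_mx n V *m const_poly_mx n C = 1%:M.
  rewrite -map_mxM -[1%:M](map_mx1 (@mpolyC n k)); congr map_mx.
  apply/eqP; rewrite -subr_eq0; apply/eqP/const_mul_generators_inj.
  rewrite /const_poly_mx map_mxB map_mx1 map_mxM mulmxBl mul1mx.
  by rewrite -mulmxA -CE -VE subrr.
have [F FE] : exists F, edge_syzygies *m const_poly_mx n V = F *m res_diff R 0.
  have /fin_all_exists[F FE] j : exists w : 'rV_(res_rank R 1),
      row j (edge_syzygies *m const_poly_mx n V) = w *m res_diff R 0.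
    apply/res_exact0.
    by rewrite -row_mul -mulmxA -VE edge_syzygies_generators row0.
  by exists (\matrix_j F j); apply/row_matrixP => j; rewrite FE row_mul rowK.
have [E EE] : exists E,
    res_diff R 0 *m const_poly_mx n C = const_poly_mx n E *m edge_syzygies.
  have /fin_all_exists[E EE] r : exists e,
      row r (res_diff R 0 *m const_poly_mx n C) =
      const_poly_mx n e *m edge_syzygies.
    apply: linear_syzygies => [j|].
      by rewrite mxE; apply: homog_mx_mul_const.
    rewrite -row_mul -mulmxA -CE row_mul; apply/res_exact0.
    by exists (delta_mx 0 r); rewrite -rowE.
  exists (\matrix_r E r); apply/row_matrixP => r; rewrite EE row_mul.
  by congr (_ *m _); apply/rowP => j; rewrite !mxE.
have dE0 : res_diff R 1 *m const_poly_mx n E = 0.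
  apply/row_matrixP => r; rewrite row0.
  have /(edge_syzygies_kernel _ hit)[g gE] :
      row r (res_diff R 1 *m const_poly_mx n E) *m edge_syzygies = 0.
    rewrite -row_mul -mulmxA -EE mulmxA row_mul.
    suff -> : row r (res_diff R 1 *m res_diff R 0) = 0 by rewrite mul0mx.
    rewrite row_mul; apply/res_exactS; exists (delta_mx 0 r); exact: rowE.
  apply/rowP => j; rewrite [RHS]mxE; apply/eqP; rewrite -msupp_eq0.
  have lin_j : row r (res_diff R 1 *m const_poly_mx n E) 0 j \is 1.-homog.
    by rewrite mxE; apply: homog_mx_mul_const.
  case supp : (msupp _) => [//|v s].
  have vin : v \in msupp (row r (res_diff R 1 *m const_poly_mx n E) 0 j).
    by rewrite supp mem_head.
  have := dhomog_mf lin_j vin; move: vin; rewrite /= gE !mxE.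
  rewrite (perm_mem (msuppMX _ _)) => /mapP[w _ ->].
  by rewrite mdegD mdeg_cycle_syzygy; lia.
have FEs : (F *m const_poly_mx n E - 1%:M) *m edge_syzygies = 0.
  by rewrite mulmxBl mul1mx -mulmxA -EE mulmxA -FE -mulmxA VC1 mulmx1 subrr.
have [w wE] : exists w, cycle_syzygy *m F = w *m res_diff R 1.
  apply/res_exactS; rewrite -mulmxA -FE mulmxA.
  suff -> : cycle_syzygy *m edge_syzygies = 0 by rewrite mul0mx.
  by apply/(edge_syzygies_kernel _ hit); exists 1; rewrite scale1r.
have /fin_all_exists[h hE] j : exists g,
    row j (F *m const_poly_mx n E - 1%:M) = g *: cycle_syzygy.
  by apply/(edge_syzygies_kernel _ hit); rewrite -row_mul FEs row0.
have m0 : (0 < m)%N by lia.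
pose i := Ordinal m0.
(* (cycle_syzygy * h) cycle_syzygy = - cycle_syzygy, and the scalar
   cycle_syzygy * h has no constant term *)
have : (cycle_syzygy *m (F *m const_poly_mx n E - 1%:M)) 0 i =
    - cycle_syzygy 0 i.
  by rewrite mulmxBr mulmxA wE -mulmxA dE0 mulmx0 sub0r mulmx1 mxE.
have -> : F *m const_poly_mx n E - 1%:M = (\col_j h j) *m cycle_syzygy.
  apply/row_matrixP => j; rewrite hE row_mul; apply/rowP => l.
  by rewrite !mxE big_ord1 !mxE.
rewrite mulmxA mxE big_ord1 [X in _ = - X]mxE [X in _ * X]mxE -mulN1r.
move/mulX_inj/(congr1 (mcoeff 0%MM)).
rewrite mcoeffN mcoeff1 eqxx mxE raddf_sum big1 => [/eqP|j _].
  by rewrite eq_sym oppr_eq0 oner_eq0.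
rewrite /= !mxE mulrC mcoeffMX_le; case: ifP => // /mnm_lepP le0.
have := mdeg_cycle_syzygy j; suff /eqP-> : (full - (U_(b j) + u j) == 0)%MM.
  by rewrite mdeg0; lia.
by apply/eqP/mnmP => x; apply/eqP; have := le0 x; rewrite mnm0E leqn0.
Qed.

(** The term of degree v + u_j contributed by u_j has to cancel against the
    contribution of another generator. *)
Lemma syzygy_msupp (z : 'rV[{mpoly k[n]}]_m) j v :
  z *m generators = 0 -> v \in msupp (z 0 j) ->
  exists i, [/\ i != j, z 0 i != 0 & (u i <= v + u j)%MM].
Proof.
move=> z0 vz; have : (z *m generators) 0 0 = 0 by rewrite z0 mxE.
move/(congr1 (mcoeff (v + u j))); rewrite mxE raddf_sum mcoeff0 (bigD1 j) //=.
rewrite mxE mcoeffMX_le lem_addl addmK => sum0.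
have [i ij /eqP ui] : exists2 i, i != j &
    (z 0 i * generators i 0)@_(v + u j) != 0.
  apply/exists_inP; apply: contraTT vz => /exists_inPn no.
  rewrite mcoeff_msupp negbK; move/eqP: sum0; rewrite big1 ?addr0 // => i /no.
  by rewrite negbK => /eqP.
exists i; split=> //; move: ui; rewrite mxE mcoeffMX_le.
  by apply: contra_notN => /eqP->; rewrite mcoeff0 if_same.
by case: ifP.
Qed.

(** * The linear resolution of length two *)

Section ExplicitResolution.

Hypothesis card_missing2 : forall j, #|missing j| = 2.

(** Each monomial of z_j brings in a variable missing from u_j. When j is not
    the largest index, b_(j+1) divides all the generators of smaller index, so
    that this variable can only be b_(j+1). *)
Lemma syzygy_last_coef (z : 'rV[{mpoly k[n]}]_m) (j : 'I_m) :
  z *m generators = 0 -> (forall i : 'I_m, (j < i)%N -> z 0 i = 0) ->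
  exists g h, z 0 j = g * 'X_(b j) + h * 'X_(b (ordS j)) /\
    ((j.+1 < m)%N -> g = 0).
Proof.
move=> z0 zj; have supp := syzygy_msupp z0.
have missE := missingE card_missing2.
have [jm|jm] := ltnP j.+1 m.
  have [|h hE] := @mpolyX_factor k n U_(b (ordS j)) (z 0 j); last first.
    by exists 0, h; rewrite mul0r add0r.
  move=> v /supp[i [ij zi /mnm_lepP/(_ (b (ordS j)))]].
  have {zi} ji : (i < j)%N.
    rewrite ltn_neqAle -[_ != _ :> nat]/(i != j) ij leqNgt.
    by apply: contra zi => /zj ->.
  rewrite mnmDE !u_missing lep1mP !missE !in_set2.
  rewrite !(inj_eq (b_inj card_missing2)) eqxx orbT (inj_eq (@ordS_inj m)).
  rewrite [j == i]eq_sym (negPf ij) orbF.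
  case: eqP => [Sj|_]; last by rewrite addn0 lt0n.
  by have := ordS_cases j; rewrite Sj; lia.
have [|g [h E]] :=
  @variable_ideal_pair k n (b j) (b (ordS j)) (z 0 j); last first.
  by exists g, h; split=> //; rewrite ltnNge jm.
apply/variable_ideal_msuppP => v /supp[i [ij _ /mnm_lepP le_i]]; rewrite -missE.
suff /subsetPn[x xj xi] : ~~ (missing j \subset missing i).
  by exists x => //; have := le_i x; rewrite mnmDE !u_missing xj xi addn0.
apply: contraNN ij => ji; apply/eqP/u_inj/mnmP => x; rewrite !u_missing.
suff -> : missing j = missing i by [].
by apply/eqP; rewrite eqEcard ji !card_missing2.
Qed.

(** The coefficients are cancelled one at a time, from the largest index down.
    The first one needs the edge relations on both sides of the generator, the
    next ones only the relation with the previous generator, so that the zeros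
    already obtained are kept. *)
Lemma generators_syzygies (z : 'rV[{mpoly k[n]}]_m) :
  z *m generators = 0 <-> exists w, z = w *m edge_syzygies.
Proof.
split=> [z0|[w ->]]; last by rewrite -mulmxA edge_syzygies_generators mulmx0.
suff cancel t : forall z : 'rV_m, z *m generators = 0 ->
    (forall i : 'I_m, (t <= i)%N -> z 0 i = 0) ->
    exists w, z = w *m edge_syzygies.
  by apply: (cancel m) => // i; rewrite leqNgt ltn_ord.
elim: t => [|t IHt] {}z {}z0 zt.
  by exists 0; rewrite mul0mx; apply/rowP => i; rewrite zt // mxE.
have [tm|tm] := ltnP t m; last first.
  by apply: IHt => // i it; have := ltn_ord i; lia.
pose j := Ordinal tm.
have [t0|t0] := posnP t.
  exists 0; rewrite mul0mx; apply/rowP => i; rewrite [RHS]mxE.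
  have [i0|i0] := posnP i; last by apply: zt; rewrite t0.
  apply/eqP; rewrite -msupp_eq0; case supp : (msupp _) => [//|v s].
  have [|i' [i'i /eqP[]]] := @syzygy_msupp z i v z0.
    by rewrite supp mem_head.
  apply: zt; rewrite t0 lt0n -i0; exact: i'i.
have [|g [h [zj g0]]] := @syzygy_last_coef z j z0; first exact: zt.
pose w : 'rV[{mpoly k[n]}]_m :=
  g *: delta_mx 0 j - h *: delta_mx 0 (ord_pred j).
have wE i : w 0 i = g *+ (i == j) - h *+ (i == ord_pred j).
  by rewrite !mxE !eqxx /= !mulr_natr.
have [||w' w'E] := IHt (z - w *m edge_syzygies); last first.
- by exists (w' + w); rewrite mulmxDl -w'E subrK.
- move=> i ti; rewrite 2!mxE -{2}[i]ord_predK mul_edge_syzygies ord_predK !wE.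
  rewrite (inj_eq (@ord_pred_inj m)).
  have [->|ij] := eqVneq i j.
    have pj : ord_pred j != j by apply: ord_pred_neq; lia.
    rewrite [j == ord_pred j]eq_sym (negPf pj) !mulr1n !mulr0n subr0 sub0r.
    by rewrite a_def // ord_predK zj mulNr opprK subrr.
  have {}ti : (j < i)%N by rewrite ltn_neqAle eq_sym ij.
  rewrite zt // g0; last by have := ltn_ord i; rewrite /= in ti *; lia.
  have /negPf-> : i != ord_pred j.
    rewrite -(inj_eq (@ordS_inj m)) ord_predK; apply/eqP => Si.
    by have := ordS_cases i; rewrite Si /=; move: ti; rewrite /=; lia.
  by rewrite !mul0rn !subr0 !mul0r !subrr.
by rewrite mulmxBl z0 -mulmxA edge_syzygies_generators mulmx0 subrr.
Qed.

Definition cycle_rank i := match i with 0 | 1 => m | 2 => 1%N | _ => 0%N end.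

Definition cycle_diff i : 'M[{mpoly k[n]}]_(cycle_rank i.+1, cycle_rank i) :=
  match i with 0 => edge_syzygies | 1 => cycle_syzygy | _ => 0 end.

Lemma cycle_linear_resolution (I : {mpoly k[n]} -> Prop) :
  (forall x, exists j, x \notin missing j) ->
  squarefree_monomial_ideal I ->
  (forall w, mon_gens I w <-> exists j, w = u j) ->
  has_linear_resolution I d.
Proof.
move=> hit sqfI IG; have m0 : (0 < m)%N by lia.
have cycle_deg j : mdeg (full - (U_(b j) + u j)) = 1%N.
  by rewrite mdeg_cycle_syzygy -(card_missing (Ordinal m0)) card_missing2; lia.
unshelve eexists (@MinGradedResolution k n I 2 cycle_rank (fun i _ => d + i)%N
  generators cycle_diff _ _ _ _ _ _ _); last by [].
- by case=> [|[|[]]].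
- by move=> r; rewrite mxE dhomogX /= u_deg addn0.
- move=> i r c; rewrite /shift_homog leq_add2l leqnSn subnDl subSnn.
  case: i r c => [|[|i]] r c; last by rewrite mxE rpred0.
    by rewrite mxE rpredB // rpredMn // dhomogX /= mdeg1.
  by rewrite mxE dhomogX /= cycle_deg.
- exact: generators_span.
- exact: generators_syzygies.
- case=> [|[|i]] v; last first.
  + split=> [_|[w ->]]; last by rewrite mulmx0.
    by exists 0; apply/rowP => c; case: (notF (ltn_ord c)).
  + split=> [v0|[w ->]]; last by rewrite mulmx0 mul0mx.
    exists 0; rewrite mul0mx; apply/rowP => i; rewrite (ord1 i) [RHS]mxE.
    have : (v *m cycle_syzygy) 0 (Ordinal m0) = 0 by rewrite v0 mxE.
    rewrite mxE big_ord1 [X in _ * X]mxE => /eqP; rewrite mulf_eq0.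
    by rewrite (negPf (mpolyX_neq0 _ _)) orbF => /eqP.
  apply: (iff_trans (edge_syzygies_kernel v hit)); split=> [[g ->]|[w ->]].
    by exists g%:M; rewrite mul_scalar_mx.
  by exists (w 0 0); rewrite {1}[w]mx11_scalar mul_scalar_mx.
case=> [|[|i]] r c; last by case: r.
  exists [:: (1 *+ (c == r), 'X_(b r)); (- (1 *+ (c == ordS r)), 'X_(a r))].
    by move=> p; rewrite !inE => /orP[]/eqP->; eexists.
  by rewrite mxE big_cons big_seq1 /= mulNr !mulrnAl !mul1r.
have /existsP[l /eqP lE] :=
  etrans (esym (mdeg_eq1 _)) (introT eqP (cycle_deg c)).
exists [:: (1, 'X_l)]; first by move=> p; rewrite inE => /eqP->; exists l.
by rewrite big_seq1 mul1r mxE lE.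
Qed.

End ExplicitResolution.

End Syzygies.

End CyclicGenerators.

(** * The equivalence *)

Theorem theorem1p17 (k : fieldType) (n : nat) (I : {mpoly k[n]} -> Prop)
    (d m : nat) (u : 'I_m -> 'X_{1..n})
    (hI : squarefree_monomial_ideal I)
    (hd : generated_in_degree I d)
    (u_inj : injective u)
    (hu : forall w, mon_gens I w <-> exists j, w = u j)
    (hgcd : forall w, (forall j, (w <= u j)%MM) -> w = 0%MM)
    (hvar : forall x : 'I_n, exists j, (U_(x) <= u j)%MM)
    (hm : (4 <= m)%N)
    (hC : forall i j, lin_adj (u i) (u j) <-> cycle_adj i j) :
  [<-> has_linear_resolution I d;
       exists (e : m = n) (s : 'S_n), forall i j : 'I_m,
         i <> j -> ordS i <> j -> (U_(s (cast_ord e i)) <= u j)%MM;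
       variable_decomposable I;
       has_linear_quotients I].
Proof.
have sq j : squarefree (u j).
  have [A sqA /mon_gens_least gensA] := hI.
  by apply/sqA/gensA/hu; exists j.
have deg j : mdeg (u j) = d by apply/hd/hu; exists j.
have /fin_all_exists[b /fin_all_exists[a ab_edge]] j : exists x y,
    (U_(x) + u j)%MM = (U_(y) + u (ordS j))%MM.
  have /hC[_ [x [y E]]] : cycle_adj j (ordS j) by left.
  by exists x, y.
have miss x : exists j, x \in missing u j.
  apply/existsP; apply: contraT => /existsPn all_x.
  suff /mnmP/(_ x) : U_(x)%MM = 0%MM :> 'X_{1..n} by rewrite mnm1E mnm0E eqxx.
  by apply: hgcd => j; rewrite -[(_ <= _)%MM]negbK -missing_div all_x.
have hit x : exists j, x \notin missing u j.
  by have [j xj] := hvar x; exists j; rewrite missing_div negbK.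
tfae.
- move=> /(linear_resolution_card_missing sq deg u_inj hm hC ab_edge hit hI hu).
  by move/(cyclic_labelling sq u_inj hm hC ab_edge); apply.
- case=> e [s div_s].
  apply: (cycle_variable_decomposable sq u_inj hm hC ab_edge) => //.
  apply: (card_missing_of_labelling sq u_inj hm hC ab_edge
    (s := fun i => s (cast_ord e i))) => // x.
  by exists (cast_ord (esym e) (s^-1%g x)); rewrite cast_ordKV permKV.
- exact: variable_decomposable_linear_quotients.
move=> lq; have two :=
  linear_quotients_card_missing sq deg u_inj hm hC ab_edge miss hit hu lq.
exact: (cycle_linear_resolution sq deg u_inj hm hC ab_edge two hit hI hu).
Qed.
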